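(* Let $X$ be a locally compact, paracompact Hausdorff space, and let $p:\mathcal G\to X$ be a locally trivial group bundle with fibre a locally compact group $G_0$ and structure group $K$. Let $\varphi_0:C_0(G_0)\to\mathbb C$ denote a left (resp. right) Haar measure such that $\varphi_0\circ\alpha=\varphi_0$ for all $\alpha\in K$. Then there is a left (resp. right) invariant positive $C_0(X)$-functional on $C_0(\mathcal G)$.
   Context: A bundle is a surjective continuous map of locally compact Hausdorff spaces. A group bundle $p:\mathcal G\to X$ is a bundle such that each fibre $G_x:=p^{-1}(x)$ is a locally compact group in the topology induced by $\mathcal G$. $K$ is a topological group acting continuously by proper homeomorphisms on $G_0$, hence by automorphisms on $C_0(G_0)$; elements of $K$ are identified with the corresponding automorphisms of $C_0(G_0)$. Local triviality with fibre $G_0$ and structure group $K$ means that $X$ has an open cover $\{U_i\}$ with bundle isomorphisms $p^{-1}(U_i)\simeq U_i\times G_0$ that are group isomorphisms on each fibre, and whose transition maps are given by a $K$-valued cocycle $U_i\cap U_j\to K$. ''Haar measure $\varphi_0:C_0(G_0)\to\mathbb C$'' means a nonzero positive linear functional on $C_0(G_0)$ invariant under left (resp. right) translations. A positive $C_0(X)$-functional is a linear positive map $\varphi:C_0(\mathcal G)\to C_0(X)$ with $\varphi(fz)=f\varphi(z)$ for $f\in C_0(X)$, $z\in C_0(\mathcal G)$, where $fz:=(f\circ p)z$. It induces, for every $x\in X$, a unique positive functional $\varphi_x:C_0(G_x)\to\mathbb C$ with $\varphi(z)(x)=\varphi_x(z|_{G_x})$. It is left (resp. right) invariant if for all $x\in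 X$, $y\in G_x$, $\xi\in C_0(G_x)$ one has $\varphi_x(\xi(y^{-1}\,\cdot\,))=\varphi_x(\xi)$ (resp. $\varphi_x(\xi(\,\cdot\,y))=\varphi_x(\xi)$); each $\varphi_x$ is understood to be nonzero, i.e. a Haar measure. *)

(* Defs.v *)
From HB Require Import structures.
From mathcomp Require Import all_boot all_order all_algebra.
From mathcomp Require Import complex.
From mathcomp Require Import all_classical all_reals topology normedtype.

Set Implicit Arguments.
Unset Strict Implicit.
Unset Printing Implicit Defensive.

Import Order.TTheory GRing.Theory Num.Theory.
Import numFieldNormedType.Exports.

Local Open Scope classical_set_scope.
Local Open Scope ring_scope.
Local Open Scope complex_scope.

Definition paracompact (T : topologicalType) : Prop :=
  forall UU : set (set T),
    (forall U, UU U -> open U) -> \bigcup_(U in UU) U = [set: T] ->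
    exists VV : set (set T),
      [/\ forall V, VV V -> open V,
          \bigcup_(V in VV) V = [set: T],
          forall V, VV V -> exists2 U, UU U & V `<=` U
        & forall x : T, exists2 N, nbhs x N &
            finite_set [set V | VV V /\ V `&` N !=set0]].

Definition proper_map (S T : topologicalType) (f : S -> T) : Prop :=
  forall A, compact A -> compact (f @^-1` A).

Lemma homeo_proper (S T : topologicalType) (f : S -> T) (g : T -> S) :
  continuous g -> cancel f g -> cancel g f -> proper_map f.
Proof.
move=> cg fK gK A cA.
suff -> : f @^-1` A = g @` A.
  by apply: continuous_compact => //; exact: continuous_subspaceT.
apply/seteqP; split=> [x /= Afx|_ [y Ay <-]] /=; first by exists (f x).
by rewrite gK.
Qed.

Lemma set_val_proper (T : topologicalType) (A : set T) :
  closed A -> proper_map (set_val : A -> T).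
Proof.
move=> clA K cK F PF FK.
have cKA : compact (K `&` A) by exact: compact_closedI.
have FKA : nbhs (set_val @ F) (K `&` A).
  change (F (set_val @^-1` (K `&` A))); apply: filterS FK => a /= Ka.
  by split=> //; exact: set_mem (valP a).
have := cKA _ (fmap_proper_filter _ PF) FKA; move=> [y [[Ky Ay] Fy]].
exists (exist _ y (mem_set Ay)); split=> // B N FB.
rewrite nbhsE => -[_ [[W oW <-] /= Wy] WN].
have FvB : nbhs (set_val @ F) (set_val @` B).
  change (F (set_val @^-1` (set_val @` B))).
  by apply: filterS FB => b Bb /=; exists b.
have [_ [[b Bb <-] Wb]] := Fy _ W FvB (open_nbhs_nbhs (conj oW Wy)).
by exists b; split=> //; exact: WN.
Qed.

HB.mixin Record isTopologicalGroup G of Topological G & Group G := {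
  mulg_continuous : continuous (fun z : G * G => (z.1 * z.2)%g);
  invg_continuous : continuous (fun x : G => (x^-1)%g)
}.

#[short(type="topGroupType")]
HB.structure Definition TopGroup :=
  {G of isTopologicalGroup G & Topological G & Group G}.

Section translations.
Variable G : topGroupType.

Lemma lmulg_continuous (y : G) : continuous (fun x : G => (y * x)%g).
Proof.
move=> x; apply: (@continuous_comp _ _ _ (fun x : G => (y, x))
  (fun z : G * G => (z.1 * z.2)%g)); last exact: mulg_continuous.
by apply: cvg_pair; [exact: cvg_cst|exact: cvg_id].
Qed.

Lemma rmulg_continuous (y : G) : continuous (fun x : G => (x * y)%g).
Proof.
move=> x; apply: (@continuous_comp _ _ _ (fun x : G => (x, y))
  (fun z : G * G => (z.1 * z.2)%g)); last exact: mulg_continuous.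
by apply: cvg_pair; [exact: cvg_id|exact: cvg_cst].
Qed.

Lemma lmulg_proper (y : G) : proper_map (fun x : G => (y * x)%g).
Proof.
apply: (@homeo_proper _ _ _ (fun x : G => (y^-1 * x)%g)) => [|x|x].
- exact: lmulg_continuous.
- by rewrite mulgA mulVg mul1g.
- by rewrite mulgA mulgV mul1g.
Qed.

Lemma rmulg_proper (y : G) : proper_map (fun x : G => (x * y)%g).
Proof.
apply: (@homeo_proper _ _ _ (fun x : G => (x * y^-1)%g)) => [|x|x].
- exact: rmulg_continuous.
- by rewrite -mulgA mulgV mulg1.
- by rewrite -mulgA mulVg mulg1.
Qed.

End translations.

Record continuous_action (K : topGroupType) (T : topologicalType) :=
  ContinuousAction {
  act :> K -> T -> T;
  act1 : forall t, act 1%g t = t;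
  actM : forall k l t, act (k * l)%g t = act k (act l t);
  act_continuous2 : continuous (fun z : K * T => act z.1 z.2);
  act_proper : forall k, proper_map (act k)
}.

Lemma act_continuous (K : topGroupType) (T : topologicalType)
  (a : continuous_action K T) (k : K) : continuous (a k).
Proof.
move=> t; apply: (@continuous_comp _ _ _ (fun t : T => (k, t))
  (fun z : K * T => a z.1 z.2)); last exact: act_continuous2.
by apply: cvg_pair; [exact: cvg_cst|exact: cvg_id].
Qed.

Section C0.
Variable R : realType.
Local Notation C := (R[i]^o).

(* For [e] in [R[i]], [0 < e] means that [e] is a positive real. *)
Definition vanishes_at_infinity (T : topologicalType) (f : T -> C) : Prop :=
  forall e : R[i], 0 < e -> compact [set x | e <= `|f x|].

Definition C0_pred (T : topologicalType) : {pred T -> C} :=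
  mem [set f : T -> C | continuous f /\ vanishes_at_infinity f].

Lemma Re_normc_continuous (T : topologicalType) (f : T -> C) :
  continuous f -> continuous (fun x => complex.Re `|f x| : R).
Proof.
move=> cf x; apply/cvgrPdist_lt => e e0.
have e0C : 0 < e%:C by rewrite ltcR.
have := @cvgr_dist_lt _ _ _ _ _ f (f x) (cf x) _ e0C.
move=> /(_ (nbhs_filter x)); apply: filterS => y fxy.
rewrite -ltcR -raddfB; apply: le_lt_trans (normc_ge_Re _) _.
exact: le_lt_trans (ler_dist_dist (f x : R[i]) (f y)) fxy.
Qed.

Lemma normc_geE (e : R[i]) (z : C) : 0 < e ->
  (e <= `|z|) = (complex.Re e <= complex.Re `|z|).
Proof. by rewrite ltcE normc_def !lecE /= => /andP[/eqP -> _]; rewrite eqxx. Qed.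

Lemma closed_normc_ge (T : topologicalType) (f : T -> C) (e : R[i]) :
  continuous f -> 0 < e -> closed [set x | e <= `|f x|].
Proof.
move=> cf e0.
have -> : [set x | e <= `|f x|] =
    (fun x => complex.Re `|f x| : R) @^-1` [set r | complex.Re e <= r].
  by apply/seteqP; split=> x /=; rewrite normc_geE.
apply: preimage_closed; last exact: closed_ge.
by move=> x _; exact: Re_normc_continuous.
Qed.

Lemma C0_dominated (T : topologicalType) (f g : T -> C) (M : R[i]) :
  0 < M -> vanishes_at_infinity g -> continuous f ->
  (forall x, `|f x| <= M * `|g x|) -> vanishes_at_infinity f.
Proof.
move=> M0 g0 cf fg e e0.
apply: (subclosed_compact _ (g0 (M^-1 * e) _)) => [||x /= ex].
- exact: closed_normc_ge.
- by rewrite mulr_gt0// invr_gt0.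
- by rewrite ler_pdivrMl// (le_trans ex).
Qed.

Lemma C0_submod_closed (T : topologicalType) :
  submod_closed (@C0_pred T).
Proof.
split=> [|a f g].
  rewrite inE; split; first exact: cst_continuous.
  move=> e e0; rewrite (_ : [set x | _] = set0); first exact: compact0.
  by apply/seteqP; split=> x //=; rewrite normr0 (lt_geF e0).
rewrite !inE => -[cf f0] [cg g0].
have caf : continuous (a *: f : T -> C).
  by move=> x; apply: cvgZl_tmp; exact: cf.
have cafg : continuous (a *: f + g : T -> C).
  by move=> x; apply: cvgD; [exact: caf|exact: cg].
split=> // e e0.
have M0 : 0 < 1 + `|a| by rewrite ltr_wpDr.
have afv : vanishes_at_infinity (a *: f : T -> C).
  apply: (C0_dominated M0 f0) => // x.
  by rewrite normrZ ler_wpM2r// lerDr.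
have e20 : 0 < e / 2 by rewrite divr_gt0.
apply: (subclosed_compact _ (compactU (afv _ e20) (g0 _ e20))).
  exact: closed_normc_ge.
move=> x /= efg.
have e2r := gtr0_real e20.
case: (real_leP e2r (normr_real ((a *: f : T -> C) x))) => [?|af2]; first by left.
case: (real_leP e2r (normr_real (g x))) => [?|g2]; first by right.
have := le_lt_trans (le_trans efg (ler_normD _ _)) (ltrD af2 g2).
by rewrite -splitr ltxx.
Qed.

HB.instance Definition _ (T : topologicalType) :=
  GRing.isSubmodClosed.Build R[i] (T -> C) (@C0_pred T)
    (GRing.submod_closed_semi (@C0_submod_closed T)).

Record C0 (T : topologicalType) := MkC0 {
  C0_fun :> T -> C;
  C0_funP : C0_fun \in @C0_pred T
}.

HB.instance Definition _ (T : topologicalType) := [isSub for @C0_fun T].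
HB.instance Definition _ (T : topologicalType) := [Choice of C0 T by <:].
HB.instance Definition _ (T : topologicalType) :=
  [SubChoice_isSubLmodule of C0 T by <:].

Lemma C0_continuous (T : topologicalType) (f : C0 T) : continuous f.
Proof. by have := C0_funP f; rewrite inE => -[]. Qed.

Lemma C0_vanishes (T : topologicalType) (f : C0 T) : vanishes_at_infinity f.
Proof. by have := C0_funP f; rewrite inE => -[]. Qed.

Lemma C0_bounded (T : topologicalType) (f : C0 T) :
  exists2 M : R[i], 0 < M & forall x, `|f x| <= M.
Proof.
pose h x : R := complex.Re `|f x|.
have ch : continuous h by exact/Re_normc_continuous/C0_continuous.
have := continuous_compact (continuous_subspaceT ch)
  (@C0_vanishes _ f _ (ltr01 : 0 < (1 : R[i]))).
move=> /compact_bounded[N [_ hN]].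
pose M := Num.max 1 (N + 1).
have M1 : 1 <= M by rewrite le_max lexx.
exists M%:C; first by rewrite ltcR (lt_le_trans ltr01).
move=> x; have hE : `|f x| = (h x)%:C by rewrite /h normc_def.
rewrite hE lecR; have [hx1|hx1] := leP (h x) 1; first exact: le_trans hx1 M1.
rewrite le_max; apply/orP; right; apply: le_trans (ler_norm _) _.
apply: (hN (N + 1)); first by rewrite ltrDl.
by exists x => //=; rewrite hE -[1](rmorph1 (real_complex R)) lecR ltW.
Qed.

Lemma C0_comp_subproof (S T : topologicalType) (f : S -> T) (z : C0 T) :
  continuous f -> proper_map f -> (z \o f : S -> C) \in @C0_pred S.
Proof.
move=> cf pf; rewrite inE; split=> [s|e e0].
  exact: (@continuous_comp _ _ _ f z s (cf s) (@C0_continuous _ z (f s))).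
exact: (pf [set t | e <= `|z t|] (@C0_vanishes _ z _ e0)).
Qed.

Definition C0_comp (S T : topologicalType) (f : S -> T)
    (cf : continuous f) (pf : proper_map f) (z : C0 T) : C0 S :=
  MkC0 (C0_comp_subproof z cf pf).

Lemma C0_act_subproof (E X : topologicalType) (p : E -> X) (f : C0 X)
    (z : C0 E) : continuous p ->
  (fun e => f (p e) * z e : C) \in @C0_pred E.
Proof.
move=> cp; have [M M0 fM] := C0_bounded f.
have cfz : continuous (fun e => f (p e) * z e : C).
  move=> e; apply: (@cvgM _ _ _ _ (f \o p : E -> C) z (f (p e)) (z e)).
    exact: (@continuous_comp _ _ _ p f e (cp e) (@C0_continuous _ f (p e))).
  exact: (@C0_continuous _ z e).
rewrite inE; split=> //; apply: (C0_dominated M0 (@C0_vanishes _ z)) => // e.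
by rewrite normrM ler_wpM2r.
Qed.

(* The action [f z := (f \o p) * z] of [C_0(X)] on [C_0(E)]. *)
Definition C0_act (E X : topologicalType) (p : E -> X) (cp : continuous p)
    (f : C0 X) (z : C0 E) : C0 E :=
  MkC0 (C0_act_subproof f z cp).

Definition C0_mul (X : topologicalType) (f g : C0 X) : C0 X :=
  C0_act (fun x => @cvg_id _ (nbhs x)) f g.

Definition positive_functional (T : topologicalType)
    (phi : {linear C0 T -> C}) : Prop :=
  forall xi : C0 T, (forall t, 0 <= xi t) -> 0 <= phi xi.

Section Haar.
Variable G : topGroupType.

Definition ltranslate (y : G) (xi : C0 G) : C0 G :=
  C0_comp (@lmulg_continuous G y^-1%g) (@lmulg_proper G y^-1%g) xi.

Definition rtranslate (y : G) (xi : C0 G) : C0 G :=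
  C0_comp (@rmulg_continuous G y) (@rmulg_proper G y) xi.

Definition left_Haar (phi : {linear C0 G -> C}) : Prop :=
  [/\ positive_functional phi, exists xi, phi xi <> 0
    & forall y xi, phi (ltranslate y xi) = phi xi].

Definition right_Haar (phi : {linear C0 G -> C}) : Prop :=
  [/\ positive_functional phi, exists xi, phi xi <> 0
    & forall y xi, phi (rtranslate y xi) = phi xi].

End Haar.

(* The automorphism [xi |-> xi (k^-1 .)] of [C_0(T)] given by [k]. *)
Definition C0_aut (K : topGroupType) (T : topologicalType)
    (a : continuous_action K T) (k : K) (xi : C0 T) : C0 T :=
  C0_comp (@act_continuous K T a k^-1%g) (@act_proper K T a k^-1%g) xi.

End C0.

Record bundle (X E : topologicalType) := Bundle {
  bproj :> E -> X;
  base_hausdorff : hausdorff_space X;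
  base_locally_compact : locally_compact [set: X];
  total_hausdorff : hausdorff_space E;
  total_locally_compact : locally_compact [set: E];
  bproj_continuous : continuous bproj;
  bproj_surj : forall x, exists e, bproj e = x
}.

(* As a [set_type], [fibre p x] carries the topology induced by [E]. *)
Notation fibre p x := (set_type (p @^-1` [set x])).

Record group_bundle (X E : topologicalType) := GroupBundle {
  gbundle :> bundle X E;
  fib_one : forall x, fibre gbundle x;
  fib_inv : forall x, fibre gbundle x -> fibre gbundle x;
  fib_mul : forall x, fibre gbundle x -> fibre gbundle x -> fibre gbundle x;
  fib_mulA : forall x, associative (@fib_mul x);
  fib_mul1g : forall x, left_id (fib_one x) (@fib_mul x);
  fib_mulg1 : forall x, right_id (fib_one x) (@fib_mul x);
  fib_mulVg : forall x, left_inverse (fib_one x) (@fib_inv x) (@fib_mul x);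
  fib_mulgV : forall x, right_inverse (fib_one x) (@fib_inv x) (@fib_mul x);
  fib_mul_continuous : forall x, continuous
    (fun z : fibre gbundle x * fibre gbundle x => fib_mul z.1 z.2);
  fib_inv_continuous : forall x, continuous (@fib_inv x);
  fibre_locally_compact :
    forall x, locally_compact [set: fibre gbundle x]
}.

Definition gfibre (X E : topologicalType) (B : group_bundle X E) (x : X) :
  Type := fibre B x.

Section gfibre.
Variables (X E : topologicalType) (B : group_bundle X E) (x : X).

HB.instance Definition _ := Topological.copy (gfibre B x) (fibre B x).
HB.instance Definition _ := isGroup.Build (gfibre B x)
  (@fib_mulA _ _ B x) (@fib_mul1g _ _ B x) (@fib_mulg1 _ _ B x)
  (@fib_mulVg _ _ B x) (@fib_mulgV _ _ B x).
HB.instance Definition _ := isTopologicalGroup.Build (gfibre B x)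
  (@fib_mul_continuous _ _ B x) (@fib_inv_continuous _ _ B x).

Definition gfibre_val (g : gfibre B x) : E := set_val g.

Lemma gfibre_val_continuous : continuous gfibre_val.
Proof. exact: initial_continuous. Qed.

Lemma gfibre_val_proper : proper_map gfibre_val.
Proof.
apply: set_val_proper; apply: preimage_closed.
  by move=> e _; exact: bproj_continuous.
apply: accessible_closed_set1; apply: hausdorff_accessible.
exact: base_hausdorff B.
Qed.

End gfibre.

(* A homeomorphism [p^-1(U) ~ U * G0] over [U] that is an isomorphism of
   groups on each fibre. The two maps are total; only their restrictions to
   [p^-1(U)] and [U * G0] are constrained. *)
Record trivialization (X E : topologicalType) (B : group_bundle X E)
    (G0 : topGroupType) (U : set X) := Trivialization {
  triv : E -> X * G0;
  triv_inv : X * G0 -> E;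
  triv_continuous : {within B @^-1` U, continuous triv};
  triv_inv_continuous : {within U `*` [set: G0], continuous triv_inv};
  triv_fst : forall e, U (B e) -> (triv e).1 = B e;
  triv_inv_bproj : forall x h, U x -> B (triv_inv (x, h)) = x;
  trivK : forall e, U (B e) -> triv_inv (triv e) = e;
  triv_invK : forall x h, U x -> triv (triv_inv (x, h)) = (x, h);
  trivM : forall x (g h : gfibre B x), U x ->
    (triv (gfibre_val (g * h)%g)).2 =
    ((triv (gfibre_val g)).2 * (triv (gfibre_val h)).2)%g
}.

Definition locally_trivial (X E : topologicalType) (B : group_bundle X E)
    (G0 K : topGroupType) (a : continuous_action K G0) : Prop :=
  exists (I : Type) (U : I -> set X)
         (t : forall i, trivialization B G0 (U i)) (k : I -> I -> X -> K),
  [/\ forall i, open (U i),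
      \bigcup_i U i = [set: X],
      forall i j, {within U i `&` U j, continuous (k i j)},
      forall i j l x, U i x -> U j x -> U l x ->
        (k i j x * k j l x)%g = k i l x
    & forall i j x h, U i x -> U j x ->
        triv (t i) (triv_inv (t j) (x, h)) = (x, a (k i j x) h)].

Section functionals.
Variables (R : realType) (X E : topologicalType) (B : group_bundle X E).

Definition positive_C0_functional (phi : {linear C0 R E -> C0 R X}) : Prop :=
  (forall z : C0 R E, (forall e, 0 <= z e) -> forall x, 0 <= phi z x) /\
  (forall (f : C0 R X) (z : C0 R E),
     phi (C0_act (@bproj_continuous _ _ B) f z) = C0_mul f (phi z)).

Definition C0_restrict (x : X) (z : C0 R E) : C0 R (gfibre B x) :=
  C0_comp (@gfibre_val_continuous _ _ B x) (@gfibre_val_proper _ _ B x) z.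

(* The induced functional [phi_x] is unique, since every element of
   [C_0(G_x)] is the restriction of one of [C_0(E)]. *)
Definition induced_at (phi : {linear C0 R E -> C0 R X}) (x : X)
    (phix : {linear C0 R (gfibre B x) -> R[i]^o}) : Prop :=
  positive_functional phix /\ forall z, phi z x = phix (C0_restrict x z).

Definition left_invariant (phi : {linear C0 R E -> C0 R X}) : Prop :=
  forall x : X, exists2 phix, @induced_at phi x phix & left_Haar phix.

Definition right_invariant (phi : {linear C0 R E -> C0 R X}) : Prop :=
  forall x : X, exists2 phix, @induced_at phi x phix & right_Haar phix.

End functionals.

(* Main.v *)
Require Import Defs.
From HB Require Import structures.
From mathcomp Require Import all_boot all_order all_algebra.
From mathcomp Require Import complex ring lra.
From mathcomp Require Import all_classical all_reals topology normedtype.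

Set Implicit Arguments.
Unset Strict Implicit.
Unset Printing Implicit Defensive.

Import Order.TTheory GRing.Theory Num.Theory.
Import numFieldNormedType.Exports.

Local Open Scope classical_set_scope.
Local Open Scope ring_scope.
Local Open Scope complex_scope.

(** The functional is built fibre by fibre.  A chart [t] over an open set
    containing [x] identifies [G0] with the fibre [G_x] as a topological group,
    and carries [phi0] to the functional
      [phi_x (xi) = phi0 (h |-> xi (t^-1 (x, h)))]
    on [C_0(G_x)].  Two charts around [x] differ by the action of an element of
    [K], which preserves [phi0], so [phi_x] does not depend on the chart
    ([chart_functional_indep]), and the local constructions agree on overlaps.
    As [phi_x] is the transport of [phi0] along an isomorphism of topological
    groups, it is a left or right Haar measure when [phi0] is
    ([transport_left_Haar], [transport_right_Haar]).

    What remains is that [x |-> phi_x (z restricted to G_x)] lies in [C_0(X)]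
    for [z] in [C_0(E)] ([chart_functional_C0]).  Both halves of this rest on
    the automatic boundedness of a positive functional on [C_0]
    ([positive_functional_bounded]).  Continuity: in a fixed chart, the slices
    [h |-> z (t^-1 (x, h))] depend on [x] continuously for the sup norm
    ([chart_uniform]), because [z] is small outside a compact set, and on that
    compact set pointwise closeness is uniform.  Vanishing at infinity: where
    the value at [x] is large, [z] is large somewhere on the fibre over [x], so
    [x] lies in the image in [X] of a compact subset of [E]. *)

(** * Functions vanishing at infinity *)

Section C0_theory.
Variable (R : realType).
Local Notation C := (R[i]^o).

Lemma C0_ext (T : topologicalType) (f g : C0 R T) :
  (forall x, f x = g x) -> f = g.
Proof. by move=> fg; apply: val_inj; apply/funext. Qed.

Lemma C0_D (T : topologicalType) (f g : C0 R T) x : (f + g) x = f x + g x.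
Proof. by []. Qed.

Lemma C0_N (T : topologicalType) (f : C0 R T) x : (- f) x = - f x.
Proof. by []. Qed.

Lemma C0_Z (T : topologicalType) (c : R[i]) (f : C0 R T) x :
  (c *: f) x = c * f x.
Proof. by []. Qed.

Lemma C0_uniform_closed (T : topologicalType) (f : T -> C) :
  (forall e : R[i], 0 < e -> exists g : C0 R T, forall x, `|f x - g x| <= e) ->
  f \in @C0_pred R T.
Proof.
move=> fg; have cf : continuous f.
  move=> x; apply/cvgrPdist_lt => e e0.
  have e20 : 0 < e / 2 by rewrite divr_gt0.
  have e40 : 0 < e / 2 / 2 by rewrite divr_gt0.
  have [g fge] := fg _ e40.
  have := @cvgr_dist_lt _ _ _ _ _ g (g x) (@C0_continuous _ _ g x) _ e20.
  move=> /(_ (nbhs_filter x)); apply: filterS => y gxy.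
  have -> : f x - f y = (f x - g x) - (f y - g y) + (g x - g y) by ring.
  rewrite (splitr e) {1}(splitr (e / 2)).
  apply: le_lt_trans (ler_normD _ _) (ler_ltD _ gxy).
  by rewrite (le_trans (ler_normB _ _))// lerD.
rewrite inE; split=> // e e0.
have e20 : 0 < e / 2 by rewrite divr_gt0.
have [g fge] := fg _ e20.
apply: (subclosed_compact _ (@C0_vanishes _ _ g _ e20)).
  exact: closed_normc_ge.
move=> x /= efx.
case: (real_leP (gtr0_real e20) (normr_real (g x))) => // ge.
have := ler_normD (f x - g x) (g x); rewrite subrK => fle.
have := le_lt_trans (le_trans efx fle) (ler_ltD (fge x) ge).
by rewrite -splitr ltxx.
Qed.

Lemma C0_lipschitz_subproof (T : topologicalType) (u : C -> C) (f : C0 R T) :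
  u 0 = 0 -> (forall z w, `|u z - u w| <= `|z - w|) ->
  (u \o f : T -> C) \in @C0_pred R T.
Proof.
move=> u0 lu; have cuf : continuous (u \o f : T -> C).
  move=> x; apply/cvgrPdist_lt => e e0.
  have := @cvgr_dist_lt _ _ _ _ _ f (f x) (@C0_continuous _ _ f x) _ e0.
  move=> /(_ (nbhs_filter x)); apply: filterS => y fxy.
  exact: le_lt_trans (lu _ _) fxy.
rewrite inE; split=> //.
apply: (@C0_dominated _ _ _ f 1) => //; first exact: C0_vanishes.
by move=> x /=; have := lu (f x) 0; rewrite u0 !subr0 mul1r.
Qed.

Definition Re_pos (z : C) : C := (Num.max (complex.Re z) 0)%:C.

Lemma Re_pos_ge0 z : 0 <= Re_pos z.
Proof. by rewrite /Re_pos lecR le_max lexx orbT. Qed.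

Lemma Re_pos_norm z : Re_pos z <= `|z|.
Proof.
rewrite /Re_pos (le_trans _ (normc_ge_Re z))// lecR ge_max normr_ge0 andbT.
exact: ler_norm.
Qed.

(** Contractions fixing [0] act on [C_0] by composition, so this is what makes
    the positive part of an element of [C_0] an element of [C_0]. *)
Lemma Re_pos_lipschitz (z w : C) : `|Re_pos z - Re_pos w| <= `|z - w|.
Proof.
apply: le_trans (normc_ge_Re (z - w)).
rewrite /Re_pos -rmorphB normc_def /= expr0n addr0 sqrtr_sqr lecR.
case: z => a b; case: w => c d /=.
have := ler_norm (a - c); have := ler_norm (c - a); rewrite (distrC c a).
by rewrite ler_norml; case: (leP a 0); case: (leP c 0); lra.
Qed.

Lemma Re_pos0 : Re_pos 0 = 0.
Proof. by rewrite /Re_pos /= maxxx. Qed.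

(** The real and imaginary parts of [z] are split into positive and negative
    parts, using [Im z = Re (- i z)]. *)
Lemma Re_pos_decomp (z : C) :
  z = Re_pos z - Re_pos (- z) + 'i * (Re_pos (- 'i * z) - Re_pos ('i * z)).
Proof.
case: z => a b; rewrite /Re_pos; simpc; apply/eqP; rewrite eq_complex /=.
have maxE (x : R) : x = Num.max x 0 - Num.max (- x) 0.
  by case: (leP x 0); case: (leP (- x) 0); lra.
by rewrite -!maxE !eqxx.
Qed.

Definition C0_pos (T : topologicalType) (f : C0 R T) : C0 R T :=
  MkC0 (C0_lipschitz_subproof f Re_pos0 Re_pos_lipschitz).

Lemma C0_pos_decomp (T : topologicalType) (f : C0 R T) :
  f = C0_pos f - C0_pos (- f)
      + 'i *: (C0_pos (- 'i *: f) - C0_pos ('i *: f)).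
Proof. by apply: C0_ext => x; exact: Re_pos_decomp. Qed.

(** * Positive functionals on C_0 are bounded *)

Lemma positive_functional_homo (T : topologicalType)
    (phi : {linear C0 R T -> C}) (f g : C0 R T) :
  positive_functional phi -> (forall x, f x <= g x) -> phi f <= phi g.
Proof.
move=> phi0 fg; rewrite -subr_ge0 -linearB; apply: phi0 => x.
by rewrite C0_D C0_N subr_ge0.
Qed.

Lemma C0_linearZ (T : topologicalType) (phi : {linear C0 R T -> C}) c f :
  phi (c *: f) = c * phi f.
Proof. exact: linearZ. Qed.

Section summable.
Variables (T : topologicalType) (g : nat -> C0 R T).
Hypothesis g01 : forall n x, 0 <= g n x <= 1.

Fixpoint dyadic_sum (n : nat) : C0 R T :=
  if n is m.+1 then dyadic_sum m + (2 ^- m)%:C *: g m else 0.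

Lemma dyadic_sumS n x :
  dyadic_sum n.+1 x = dyadic_sum n x + (2 ^- n)%:C * g n x.
Proof. by []. Qed.

(** The series of the [2^-n g_n] converges uniformly to an element [s] of
    [C_0], which dominates every partial sum because these increase.  The limit
    is taken pointwise, as a supremum of reals. *)
Lemma C0_dyadic_sum_cvg : exists s : C0 R T, forall n x, dyadic_sum n x <= s x.
Proof.
pose r n x : R := complex.Re (g n x).
pose S n x : R := complex.Re (dyadic_sum n x).
have gE n x : g n x = (r n x)%:C.
  by rewrite RRe_real// ger0_real//; case/andP: (g01 n x).
have r01 n x : 0 <= r n x <= 1.
  by have := g01 n x; rewrite gE -[1](rmorph1 (real_complex R)) !lecR.
have SE n x : dyadic_sum n x = (S n x)%:C.
  rewrite /S; elim: n => [//|n IH].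
  by rewrite dyadic_sumS IH gE -rmorphM -rmorphD.
have SS n x : S n.+1 x = S n x + 2 ^- n * r n x.
  by apply: complexI; rewrite -SE dyadic_sumS gE SE -rmorphM -rmorphD.
(* The terms of index at least [n] sum to at most [2 * 2^-n], so [D n] bounds
   every partial sum, and lies within [2 * 2^-n] of the [n]-th one. *)
pose D n x := S n x + 2 * 2 ^- n.
have p2 n : 0 < 2 ^- n :> R by rewrite invr_gt0 exprn_gt0.
have S_incr x : {homo S^~ x : m n / (m <= n)%N >-> m <= n}.
  apply: homo_leq => [//|? ? ?|n]; first exact: le_trans.
  rewrite [leRHS]SS lerDl mulr_ge0//; first exact: ltW.
  by case/andP: (r01 n x).
have D_decr x : {homo D^~ x : m n / (m <= n)%N >-> n <= m}.
  apply: homo_leq => [//|? ? ? /[swap]|n]; first exact: le_trans.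
  change (D n.+1 x <= D n x); rewrite /D SS exprS invfM.
  rewrite mulVKf; last by rewrite pnatr_eq0.
  rewrite -addrA lerD2l.
  have /andP[_ r1] := r01 n x; have := p2 n; nra.
have SD m n x : S m x <= D n x.
  apply: le_trans (S_incr x _ _ (leq_maxl m n)) _.
  apply: le_trans (D_decr x _ _ (leq_maxr m n)).
  by rewrite /D lerDl mulr_ge0// (ltW (p2 _)).
pose s x : R := sup [set S n x | n in setT].
have Ss n x : S n x <= s x.
  apply: ub_le_sup; last by exists n.
  by exists (D 0%N x) => _ [m _ <-].
have sD n x : s x <= D n x.
  by apply: ge_sup; [exists (S n x); exists n|move=> _ [m _ <-]].
have sC0 : (fun x => (s x)%:C : C) \in @C0_pred R T.
  apply: C0_uniform_closed => e; rewrite ltcE /= => /andP[/eqP e0 e1].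
  have -> : e = (complex.Re e)%:C by case: e e0 {e1} => ? ? /= ->.
  have [n ne] : exists n : nat, 2 * 2 ^- n <= complex.Re e.
    have e20 : 0 < complex.Re e / 2 by rewrite divr_gt0.
    exists (Num.bound (complex.Re e / 2)^-1).
    rewrite -ler_pdivlMl// [leRHS]mulrC.
    rewrite invf_ple ?posrE ?exprn_gt0//.
    exact/ltW/upper_nthrootP.
  exists (dyadic_sum n) => x.
  rewrite SE -rmorphB normc_def /= expr0n addr0 sqrtr_sqr lecR.
  rewrite ger0_norm ?subr_ge0// (le_trans _ ne)//.
  by rewrite lerBlDl; exact: sD.
by exists (MkC0 sC0) => n x; rewrite SE lecR.
Qed.

End summable.

(** If [phi] were unbounded on functions with values in [0, 1], one could choose
    [g_n] among them with [phi (g_n) > n 2^n].  The sum [s] of the [2^-n g_n]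
    dominates each term, so [phi s > n] for every [n]. *)
Lemma positive_functional_bounded01 (T : topologicalType)
    (phi : {linear C0 R T -> C}) : positive_functional phi ->
  exists M : nat, forall g : C0 R T,
    (forall x, 0 <= g x <= 1) -> phi g <= M%:R.
Proof.
move=> phi0; apply: contrapT => unb.
have /choice[g gP] : forall n : nat, exists g : C0 R T,
    (forall x, 0 <= g x <= 1) /\ ~ phi g <= (n * 2 ^ n)%:R.
  move=> n; apply: contrapT => no; apply: unb; exists (n * 2 ^ n)%N => g g01.
  by apply: contrapT => ng; apply: no; exists g.
have g01 n : forall x, 0 <= g n x <= 1 by case: (gP n).
have [s sP] := C0_dyadic_sum_cvg g01.
have sum_ge0 n x : 0 <= dyadic_sum g n x.
  elim: n => [//|n IH]; rewrite dyadic_sumS addr_ge0// mulr_ge0//.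
    by rewrite lecR invr_ge0 exprn_ge0.
  by case/andP: (g01 n x).
have gs n x : g n x <= ((2 ^ n)%:R *: s) x.
  rewrite C0_Z natrX -ler_pdivrMl ?exprn_gt0//; apply: le_trans (sP n.+1 x).
  rewrite dyadic_sumS fmorphV rmorphXn/= rmorph_nat.
  by rewrite lerDr.
have phis_ge n : n%:R < phi s.
  rewrite -(@ltr_pM2r _ (2 ^ n)%:R) ?ltr0n ?expn_gt0// -natrM mulrC.
  rewrite -C0_linearZ.
  apply: lt_le_trans (positive_functional_homo phi0 (gs n)).
  have [g0 gn] := gP n; rewrite real_ltNge ?realn//; first exact/negP.
  by apply/ger0_real/phi0 => x; case/andP: (g0 x).
have phis_real : (complex.Re (phi s))%:C = phi s.
  by apply/RRe_real/ger0_real; exact: ltW (phis_ge 0%N).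
have := phis_ge (Num.trunc (complex.Re (phi s))).+1.
by rewrite -phis_real -(rmorph_nat (real_complex R)) ltcR ltNge ltW ?truncnS_gt.
Qed.

(** The factor [4] comes from writing a complex function as a combination of
    four nonnegative ones. *)
Lemma positive_functional_bounded (T : topologicalType)
    (phi : {linear C0 R T -> C}) : positive_functional phi ->
  exists2 M : R[i], 0 < M & forall (f : C0 R T) (s : R[i]),
    0 < s -> (forall x, `|f x| <= s) -> `|phi f| <= M * s.
Proof.
move=> phi0; have [M MP] := positive_functional_bounded01 phi0.
exists (4 * M.+1%:R); first by rewrite mulr_gt0// ltr0Sn.
move=> f s s0 fs.
have pos_le (h : C0 R T) : (forall x, `|h x| <= s) ->
    `|phi (C0_pos h)| <= M.+1%:R * s.
  move=> hs; rewrite ger0_norm; last by apply: phi0 => x; exact: Re_pos_ge0.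
  rewrite -ler_pdivrMr// mulrC -C0_linearZ.
  apply: le_trans (MP _ _) _; last by rewrite ler_nat.
  move=> x; rewrite C0_Z mulr_ge0 ?Re_pos_ge0 ?invr_ge0 ?(ltW s0)//=.
  by rewrite ler_pdivrMl// mulr1 (le_trans (Re_pos_norm _)).
have i1 : `|'i : R[i]| = 1 by rewrite normc_def /= expr0n expr1n add0r sqrtr1.
rewrite [f]C0_pos_decomp linearD C0_linearZ !linearB.
have -> : 4 * M.+1%:R * s =
    M.+1%:R * s + M.+1%:R * s + (M.+1%:R * s + M.+1%:R * s).
  by rewrite -mulrA; ring.
apply: le_trans (ler_normD _ _) (lerD _ _).
  apply: le_trans (ler_normB _ _) (lerD _ _); apply: pos_le => // x.
  by rewrite C0_N normrN.
rewrite normrM i1 mul1r.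
by apply: le_trans (ler_normB _ _) (lerD _ _); apply: pos_le => // x;
  rewrite C0_Z normrM ?normrN i1 mul1r.
Qed.

End C0_theory.

(** * Transport of Haar measures *)

Section pullback.
Variables (R : realType) (S T : topologicalType) (f : S -> T).
Hypotheses (cf : continuous f) (pf : proper_map f).

Lemma C0_comp_linear : linear (@C0_comp R S T f cf pf).
Proof. by move=> c u v; apply: C0_ext. Qed.

HB.instance Definition _ := GRing.isLinear.Build R[i] (C0 R T) (C0 R S) *:%R
  (@C0_comp R S T f cf pf) C0_comp_linear.

End pullback.

Section Haar_transport.
Variables (R : realType) (G H : topGroupType) (u : G -> H) (v : H -> G).
Hypotheses (cu : continuous u) (cv : continuous v).
Hypotheses (uK : cancel u v) (vK : cancel v u).
Hypothesis uM : forall g h, u (g * h)%g = (u g * u h)%g.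
Variable phi : {linear C0 R G -> R[i]^o}.

Definition transport : {linear C0 R H -> R[i]^o} :=
  phi \o C0_comp cu (homeo_proper cv uK vK).

Lemma transport_positive :
  positive_functional phi -> positive_functional transport.
Proof. by move=> phi0 xi xi0; apply: phi0 => g; exact: xi0. Qed.

Lemma transport_neq0 :
  (exists xi, phi xi <> 0) -> exists xi, transport xi <> 0.
Proof.
move=> [xi xi0]; exists (C0_comp cv (homeo_proper cu vK uK) xi).
rewrite /transport /=; suff -> : C0_comp cu (homeo_proper cv uK vK)
  (C0_comp cv (homeo_proper cu vK uK) xi) = xi by [].
by apply: C0_ext => g /=; rewrite uK.
Qed.

Let u1 : u 1%g = 1%g.
Proof. by apply: (@mulgI _ (u 1%g)); rewrite -uM !mulg1. Qed.

Let uV g : u g^-1%g = (u g)^-1%g.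
Proof. by apply: (@mulgI _ (u g)); rewrite -uM !mulgV. Qed.

Lemma transport_left_Haar : left_Haar phi -> left_Haar transport.
Proof.
move=> [phi0 phiN0 phiL]; split; first exact: transport_positive.
  exact: transport_neq0.
move=> y xi; rewrite /transport /= -(phiL (v y) (C0_comp _ _ xi)).
by congr (phi _); apply: C0_ext => g /=; rewrite uM uV vK.
Qed.

Lemma transport_right_Haar : right_Haar phi -> right_Haar transport.
Proof.
move=> [phi0 phiN0 phiR]; split; first exact: transport_positive.
  exact: transport_neq0.
move=> y xi; rewrite /transport /= -(phiR (v y) (C0_comp _ _ xi)).
by congr (phi _); apply: C0_ext => g /=; rewrite uM vK.
Qed.

End Haar_transport.

(** * Charts of a locally trivial group bundle *)

Section chart.
Variables (X E : topologicalType) (B : group_bundle X E) (G0 : topGroupType).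
Variables (U : set X) (t : trivialization B G0 U).

Section chart_fibre.
Variables (x : X) (Ux : U x).

Definition to_fibre (h : G0) : gfibre B x :=
  exist _ (triv_inv t (x, h)) (mem_set (triv_inv_bproj t h Ux)).

Definition of_fibre (g : gfibre B x) : G0 := (triv t (gfibre_val g)).2.

Lemma gfibre_valK (g : gfibre B x) : B (gfibre_val g) = x.
Proof. exact: set_mem (valP g). Qed.

Lemma to_fibreK : cancel to_fibre of_fibre.
Proof. by move=> h; rewrite /of_fibre [triv _ _](triv_invK t h Ux). Qed.

Lemma of_fibreK : cancel of_fibre to_fibre.
Proof.
move=> g; apply: val_inj => /=; have gx := gfibre_valK g.
have Ug : U (B (gfibre_val g)) by rewrite gx.
rewrite -[RHS](trivK t Ug) /of_fibre; congr (triv_inv t _).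
by rewrite [RHS]surjective_pairing (triv_fst t Ug) gx.
Qed.

Lemma of_fibreM g h : of_fibre (g * h)%g = (of_fibre g * of_fibre h)%g.
Proof. exact: trivM. Qed.

Lemma to_fibreM g h : to_fibre (g * h)%g = (to_fibre g * to_fibre h)%g.
Proof.
by apply: (can_inj of_fibreK); rewrite of_fibreM !to_fibreK.
Qed.

Hypothesis Uopen : open U.

Lemma triv_inv_continuous_at h : {for (x, h), continuous (triv_inv t)}.
Proof.
have oU : open (U `*` [set: G0]).
  by rewrite setXT; apply: open_comp => // ? _; exact: cvg_fst.
have := @triv_inv_continuous _ _ _ _ _ t; rewrite continuous_open_subspace//.
by apply; rewrite inE.
Qed.

Lemma triv_continuous_at e : U (B e) -> {for e, continuous (triv t)}.
Proof.
move=> Ue; have oU : open (B @^-1` U).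
  by apply: open_comp => // ? _; exact: bproj_continuous.
have := @triv_continuous _ _ _ _ _ t; rewrite continuous_open_subspace//.
by apply; rewrite inE.
Qed.

Lemma of_fibre_continuous : continuous of_fibre.
Proof.
move=> g; have Ug : U (B (gfibre_val g)) by rewrite gfibre_valK.
apply: (@continuous_comp _ _ _ (triv t \o @gfibre_val _ _ B x) snd).
  apply: continuous_comp; first exact: gfibre_val_continuous.
  exact: triv_continuous_at.
exact: cvg_snd.
Qed.

Lemma to_fibre_continuous : continuous to_fibre.
Proof.
apply: continuous_comp_initial => h.
apply: (@continuous_comp _ _ _ (fun h : G0 => (x, h)) (triv_inv t)).
  by apply: cvg_pair; [exact: cvg_cst|exact: cvg_id].
exact: triv_inv_continuous_at.
Qed.

End chart_fibre.

Section uniform.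
Variables (R : realType) (Uopen : open U) (z : C0 R E).

(** Let [N] be a closed neighbourhood of [x0] inside the domain of the chart.
    The points over [N] where [z] is at least [e / 2] form a compact set, whose
    projection [L] to [G0] is compact.  For [h] in [L] the estimate is joint
    continuity together with a tube argument; for [h] outside [L] both values
    are below [e / 2]. *)
Lemma chart_uniform (x0 : X) (e : R[i]) : U x0 -> 0 < e ->
  \forall x \near x0, forall h,
    `|z (triv_inv t (x0, h)) - z (triv_inv t (x, h))| <= e.
Proof.
move=> Ux0 e0; have e20 : 0 < e / 2 by rewrite divr_gt0.
have [N [N0 Ncl NU]] : exists N, [/\ nbhs x0 N, closed N & N `<=` U].
  have [V] := base_locally_compact B I (x := x0); rewrite withinET => Vx [cV _].
  have [N Nx NU] := compact_regular (base_hausdorff B) cV Vx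
    (open_nbhs_nbhs (conj Uopen Ux0)).
  exists (closure N); split=> //; last exact: closed_closure.
  by apply: filterS Nx; exact: subset_closure.
pose big := [set y | e / 2 <= `|z y|] `&` B @^-1` N.
have cbig : compact big.
  apply: compact_closedI; first exact: C0_vanishes.
  by apply: preimage_closed => // ? _; exact: bproj_continuous.
pose L := (fun y => (triv t y).2) @` big.
have cL : compact L.
  apply: continuous_compact => //; apply: continuous_in_subspaceT => y.
  rewrite inE => -[_ /NU Uy].
  apply: (@continuous_comp _ _ _ (triv t) snd); last exact: cvg_snd.
  exact: triv_continuous_at.
have zc x h : U x ->
    {for (x, h), continuous (z \o triv_inv t : X * G0 -> R[i]^o)}.
  move=> Ux; apply: continuous_comp; last exact: C0_continuous.
  exact: triv_inv_continuous_at.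
have closeL : \forall x \near x0, L `<=`
    [set h | `|z (triv_inv t (x0, h)) - z (triv_inv t (x, h))| <= e].
  move/compact_near_coveringP : cL; apply => h Lh.
  pose D (q : G0 * X) : R[i]^o :=
    z (triv_inv t (x0, q.1)) - z (triv_inv t (q.2, q.1)).
  have cD : {for (h, x0), continuous D}.
    apply: cvgB.
      apply: (@continuous_comp _ _ _ (fun q : G0 * X => (x0, q.1))
        (z \o triv_inv t : X * G0 -> R[i]^o)); last exact: zc.
      by apply: cvg_pair; [exact: cvg_cst|exact: cvg_fst].
    apply: (@continuous_comp _ _ _ (fun q : G0 * X => (q.2, q.1))
      (z \o triv_inv t : X * G0 -> R[i]^o)); last exact: zc.
    by apply: cvg_pair; [exact: cvg_snd|exact: cvg_fst].
  have := @cvgr_dist_lt _ _ _ _ _ D (D (h, x0)) cD _ e0.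
  move=> /(_ (nbhs_filter (h, x0))); apply: filterS => -[h' x] /=.
  by rewrite /D /= subrr sub0r normrN => /ltW.
near=> x => h.
have Nx : N x by near: x.
have Ux := NU _ Nx.
have [Lh|Lh] := pselect (L h); first by move: h Lh; near: x.
have small y : N y -> `|z (triv_inv t (y, h))| <= e / 2.
  move=> Ny; have Uy := NU _ Ny.
  case: (real_leP (gtr0_real e20) (normr_real (z (triv_inv t (y, h))))).
    move=> zy; exfalso; apply: Lh; exists (triv_inv t (y, h)).
      by split => //=; rewrite triv_inv_bproj.
    by rewrite triv_invK.
  exact: ltW.
rewrite [e]splitr (le_trans (ler_normB _ _))// lerD// small//.
exact: nbhs_singleton.
Unshelve. all: by end_near. Qed.

End uniform.
End chart.

(** * Gluing functionals on the fibres *)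

Section fibrewise.
Variables (R : realType) (X E : topologicalType) (B : group_bundle X E).
Variable phix : forall x, {linear C0 R (gfibre B x) -> R[i]^o}.
Hypothesis phix_pos : forall x, positive_functional (@phix x).
Hypothesis phixC0 : forall z : C0 R E,
  (fun x => phix x (C0_restrict B x z) : R[i]^o) \in @C0_pred R X.

Definition fibrewise (z : C0 R E) : C0 R X := MkC0 (phixC0 z).

Lemma fibrewise_linear : linear fibrewise.
Proof.
move=> c z w; apply: C0_ext => x.
exact: (linearP (phix x \o C0_comp (@gfibre_val_continuous _ _ B x)
                                   (@gfibre_val_proper _ _ B x))).
Qed.

HB.instance Definition _ :=
  GRing.isLinear.Build R[i] (C0 R E) (C0 R X) *:%R fibrewise fibrewise_linear.

Lemma fibrewise_positive_C0_functional : positive_C0_functional B fibrewise.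
Proof.
split=> [z z0 x|f z]; first by apply: phix_pos => g; exact: z0.
apply: C0_ext => x; rewrite /= -C0_linearZ; congr (phix x _).
by apply: C0_ext => g; rewrite /= gfibre_valK.
Qed.

Lemma fibrewise_induced_at x : induced_at fibrewise (phix x).
Proof. by split; first exact: phix_pos. Qed.

End fibrewise.

Section local_charts.
Variables (R : realType) (X E : topologicalType) (B : group_bundle X E).
Variables (G0 K : topGroupType) (a : continuous_action K G0).
Variables (I : Type) (U : I -> set X).
Variables (t : forall i, trivialization B G0 (U i)) (k : I -> I -> X -> K).
Hypothesis U_open : forall i, open (U i).
Hypothesis t_change : forall i j x h, U i x -> U j x ->
  triv (t i) (triv_inv (t j) (x, h)) = (x, a (k i j x) h).
Variable phi0 : {linear C0 R G0 -> R[i]^o}.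
Hypothesis phi0_pos : positive_functional phi0.
Hypothesis phi0_invariant : forall (l : K) (xi : C0 R G0),
  phi0 (C0_aut a l xi) = phi0 xi.

Definition chart_functional i x (Ux : U i x) :
    {linear C0 R (gfibre B x) -> R[i]^o} :=
  transport (@to_fibre_continuous _ _ _ _ _ (t i) x Ux (U_open i))
    (@of_fibre_continuous _ _ _ _ _ (t i) x Ux (U_open i))
    (@to_fibreK _ _ _ _ _ (t i) x Ux) (@of_fibreK _ _ _ _ _ (t i) x Ux) phi0.

(** The slices of [xi] in the charts [i] and [j] are exchanged by
    [h |-> k_ij(x) h], and composing with this map is the automorphism of
    [C_0(G0)] given by [k_ij(x)^-1]. *)
Lemma chart_functional_indep i j x (Uix : U i x) (Ujx : U j x) :
  chart_functional Uix =1 chart_functional Ujx.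
Proof.
move=> xi; rewrite /chart_functional /transport /=.
rewrite -(phi0_invariant (k i j x)^-1%g (C0_comp _ _ xi)).
congr (phi0 _); apply: C0_ext => h /=; congr (xi _); apply: val_inj => /=.
have UBj : U i (B (triv_inv (t j) (x, h))) by rewrite triv_inv_bproj.
by rewrite -[RHS](trivK (t i) UBj) t_change// invgK.
Qed.

Variables (c : X -> I) (Uc : forall x, U (c x) x).

(** Near [x0], all the values can be computed in the one chart chosen at [x0],
    although the choice [c] of charts is arbitrary. *)
Lemma chart_functional_C0 (z : C0 R E) :
  (fun x => chart_functional (Uc x) (C0_restrict B x z) : R[i]^o)
    \in @C0_pred R X.
Proof.
pose phiz x : R[i]^o := chart_functional (Uc x) (C0_restrict B x z).
have [M M0 phiM] := positive_functional_bounded phi0_pos.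
have phiz_cont : continuous phiz.
  move=> x0; apply/cvgrPdist_lt => e e0.
  have d0 : 0 < M^-1 * (e / 2) by rewrite mulr_gt0 ?invr_gt0 ?divr_gt0.
  near=> x.
  have Ux : U (c x0) x.
    by near: x; exact: open_nbhs_nbhs (conj (U_open _) (Uc x0)).
  have close : forall h, `|z (triv_inv (t (c x0)) (x0, h)) -
                      z (triv_inv (t (c x0)) (x, h))| <= M^-1 * (e / 2).
    by near: x; exact: (chart_uniform (t (c x0)) (U_open _)).
  rewrite {2}/phiz (chart_functional_indep _ Ux).
  rewrite /phiz /chart_functional /transport /= -linearB.
  apply: (le_lt_trans (phiM _ _ d0 _)); first exact: close.
  by rewrite mulVKf ?gt_eqF// ltr_pdivrMr// ltr_pMr// ltr1n.
rewrite inE; split=> // e e0.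
have d0 : 0 < M^-1 * (e / 2) by rewrite mulr_gt0 ?invr_gt0 ?divr_gt0.
have cB : compact (B @` [set y | M^-1 * (e / 2) <= `|z y|]).
  apply: continuous_compact; last exact: C0_vanishes.
  by apply: continuous_subspaceT; exact: bproj_continuous.
apply: (subclosed_compact _ cB); first exact: closed_normc_ge.
move=> x /= ex; apply: contrapT => nx.
have small h : `|z (triv_inv (t (c x)) (x, h))| <= M^-1 * (e / 2).
  case: (real_leP (gtr0_real d0)
    (normr_real (z (triv_inv (t (c x)) (x, h))))) => [zge|/ltW//].
  exfalso; apply: nx; exists (triv_inv (t (c x)) (x, h)) => //.
  by rewrite triv_inv_bproj.
have := le_trans ex (phiM _ _ d0 _) => /(_ small).
rewrite mulVKf ?gt_eqF// ler_pdivlMr// ger_pMr//.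
by rewrite lern1.
Unshelve. all: by end_near. Qed.

End local_charts.

Theorem proposition4p3 (R : realType) (X E : topologicalType)
    (X_hausdorff : hausdorff_space X)
    (X_locally_compact : locally_compact [set: X])
    (X_paracompact : paracompact X)
    (B : group_bundle X E)
    (G0 : topGroupType)
    (G0_hausdorff : hausdorff_space G0)
    (G0_locally_compact : locally_compact [set: G0])
    (K : topGroupType) (a : continuous_action K G0)
    (B_locally_trivial : locally_trivial B a)
    (phi0 : {linear C0 R G0 -> R[i]^o})
    (phi0_invariant : forall (k : K) (xi : C0 R G0),
       phi0 (C0_aut a k xi) = phi0 xi) :
  (left_Haar phi0 ->
     exists2 phi : {linear C0 R E -> C0 R X},
       positive_C0_functional B phi & left_invariant B phi) /\
  (right_Haar phi0 ->
     exists2 phi : {linear C0 R E -> C0 R X},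
       positive_C0_functional B phi & right_invariant B phi).
Proof.
have [I [U [t [k [U_open U_cover _ _ t_change]]]]] := B_locally_trivial.
have /choice[c Uc] : forall x, exists i, U i x.
  by move=> x; have : [set: X] x by []; rewrite -U_cover => -[i _ Ux]; exists i.
pose phix x := chart_functional t U_open phi0 (Uc x).
have glue : positive_functional phi0 ->
    exists2 phi : {linear C0 R E -> C0 R X}, positive_C0_functional B phi &
      forall x, induced_at phi (phix x).
  move=> phi0_pos.
  have phix_pos x : positive_functional (phix x) by exact: transport_positive.
  have phixC0 := chart_functional_C0 U_open t_change phi0_pos phi0_invariant Uc.
  exists (fibrewise phixC0); first exact: fibrewise_positive_C0_functional.
  exact: fibrewise_induced_at.
split=> phi0_Haar; have [phi0_pos _ _] := phi0_Haar;
  have [phi phiP phi_x] := glue phi0_pos; exists phi => // x;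
  exists (phix x) => //.
- by apply: transport_left_Haar => //; exact: to_fibreM.
- by apply: transport_right_Haar => //; exact: to_fibreM.
Qed.
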